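(* Let $a\ge 4$ be an even integer, let $D$ be a difference covering array DCA$(3;a)$ in standard form, and let $\overline H$ be the $(4a-1)\times(a^2-a)$ binary matrix built from $D$ by Construction 2. Then $\overline H$ is a parity-check matrix of an $(a^2-a,4,\{a-1,a\})$-near regular binary LDPC code that satisfies the RC-constraint.
   Context: All rows and columns of matrices are indexed starting from $0$. Difference covering array: for even $a$, a DCA$(3;a)$ is an $a\times 3$ array $D=[D(i,j)]$, $0\le i\le a-1$, $0\le j\le 2$, with entries in $\{0,\dots,a-1\}$, such that (1) all entries of the first column ($j=0$) are $0$ and each of the other columns contains each of $0,\dots,a-1$ exactly once; (2) for the distinct non-zero columns $j\ne j'$, the differences $D(i,j)-D(i,j') \bmod a$, $0\le i\le a-1$, are all non-zero and cover the set $\{1,\dots,a-1\}$. It is in standard form if $D(i,1)=i$ for all $i$. (In such an array there are exactly two rows $r$ with $D(r,2)-D(r,1)\equiv a/2 \pmod a$; every other non-zero difference occurs in exactly one row.) Construction 2: let $r_0$ be one (either one) of the two rows with $D(r_0,2)-D(r_0,1)\equiv a/2\pmod a$. Let $I$ be the $a\times a$ identity matrix, let $P^i$ be the $a\times a$ $(0,1)$ circulant permutation matrix whose row $r$ has its unique entry $1$ in column $r-i\bmod a$, and for $0\le v\le a-1$ let $R_v$ be the $a\times a$ matrix whose row $v$ is all ones and whose other rows are all zeros. Let $\overline H$ be obtained from $$\begin{bmatrix} R_0&R_1&\cdots&R_{a-1}\\ I&I&\cdots&I\\ P^{D(0,1)}&P^{D(1,1)}&\cdots&P^{D(a-1,1)}\\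 P^{D(0,2)}&P^{D(1,2)}&\cdots&P^{D(a-1,2)}\end{bmatrix}$$ by deleting the $(4a)\times a$ block of columns corresponding to $v=r_0$ and then deleting row $r_0$, which has become all zero. An $(m,w_c,\{w_r-1,w_r\})$-near regular binary LDPC code is the null space over $\mathbb{Z}_2$ of a (sparse) $(0,1)$ matrix with $m$ columns, all of whose columns have exactly $w_c$ ones and each of whose rows has $w_r-1$ or $w_r$ ones (this matrix is its parity-check matrix; ''sparse'' is informal). A parity-check matrix satisfies the RC-constraint if the inner product (over the integers) of any two distinct rows is at most $1$ and that of any two distinct columns is at most $1$. *)

(* Defs.v *)
From mathcomp Require Import all_boot all_order all_algebra.

Set Implicit Arguments.
Unset Strict Implicit.
Unset Printing Implicit Defensive.

Import GRing.Theory.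
Local Open Scope ring_scope.

(* x - y mod a; the truncated subtraction is exact because y < a. *)
Definition sub_mod (a : nat) (x y : 'I_a) : nat := ((x + (a - y)) %% a)%N.

(* Columns are indexed by the numerals 0, 1, 2 : 'I_3. *)
Definition is_DCA3 (a : nat) (D : 'M['I_a]_(a, 3)) : Prop :=
  [/\ forall i, nat_of_ord (D i 0) = 0%N,
      forall j : 'I_3, j != 0 -> forall x : 'I_a, #|[set i | D i j == x]| = 1%N
    & forall j j' : 'I_3, j != 0 -> j' != 0 -> j != j' ->
        (forall i, sub_mod (D i j) (D i j') <> 0%N) /\
        (forall d : nat, (0 < d < a)%N ->
           exists i, sub_mod (D i j) (D i j') = d)].

Definition standard_form (a : nat) (D : 'M['I_a]_(a, 3)) : Prop :=
  forall i, D i 1 = i.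

Definition circulant (a : nat) (i : 'I_a) : 'M['F_2]_a :=
  \matrix_(r, c) (nat_of_ord c == sub_mod r i)%:R.

Definition ones_row (a : nat) (v : 'I_a) : 'M['F_2]_a :=
  \matrix_(r, c) (r == v)%:R.

Definition base_block (a : nat) (D : 'M['I_a]_(a, 3)) (k : 'I_4) (v : 'I_a) :
    'M['F_2]_a :=
  match nat_of_ord k with
  | 0 => ones_row v
  | 1 => 1%:M
  | 2 => circulant (D v 1)
  | _ => circulant (D v 2)
  end.

Definition base_matrix (a : nat) (D : 'M['I_a]_(a, 3)) :
    'M['F_2]_(\sum_(k < 4) a, \sum_(v < a) a) :=
  \mxblock_(k < 4, v < a) base_block D k v.

Definition delete_col_block (R : Type) (m n : nat) (q : 'I_n -> nat) (v0 : 'I_n)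
    (A : 'M[R]_(m, \sum_v q v)) : 'M[R]_(m, \sum_(v < n.-1) q (lift v0 v)) :=
  \mxrow_(v < n.-1) submxrow A (lift v0 v).

Lemma size_rows (a : nat) : (\sum_(k < 4) a).-1 = (4 * a - 1)%N.
Proof. by rewrite sum_nat_const card_ord subn1. Qed.

Lemma size_cols (a : nat) : (\sum_(v < a.-1) a = a ^ 2 - a)%N.
Proof. by rewrite sum_nat_const card_ord -subn1 mulnBl mul1n. Qed.

(* tagnat.Rank ord0 r0 is row r0 of the topmost block row. *)
Definition Hbar (a : nat) (D : 'M['I_a]_(a, 3)) (r0 : 'I_a) :
    'M['F_2]_(4 * a - 1, a ^ 2 - a) :=
  castmx (size_rows a, size_cols a)
    (row' (tagnat.Rank (ord0 : 'I_4) r0)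
       (delete_col_block r0 (base_matrix D))).

Definition null_space (l m : nat) (H : 'M['F_2]_(l, m)) :
    {vspace 'rV['F_2]_m} :=
  lker (linfun (mulmxr H^T)).

(* H is a parity-check matrix of the (m, wc, {wr - 1, wr})-near regular binary
   LDPC code C; the informal requirement that H be sparse is not rendered. *)
Definition near_regular_parity_check (l m wc wr : nat)
    (C : {vspace 'rV['F_2]_m}) (H : 'M['F_2]_(l, m)) : Prop :=
  [/\ C = null_space H,
      forall j, #|[set i | H i j == 1]| = wc
    & forall i, #|[set j | H i j == 1]| = (wr - 1)%N \/
                #|[set j | H i j == 1]| = wr].

(* The inner products are taken over the integers: the entries, in 'F_2, are
   coerced to their representatives 0 and 1 in nat. *)
Definition RC_constraint (l m : nat) (H : 'M['F_2]_(l, m)) : Prop :=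
  (forall i i' : 'I_l, i != i' ->
     (\sum_(j < m) nat_of_ord (H i j) * nat_of_ord (H i' j) <= 1)%N) /\
  (forall j j' : 'I_m, j != j' ->
     (\sum_(i < l) nat_of_ord (H i j) * nat_of_ord (H i j') <= 1)%N).

(* Main.v *)
Require Import Defs.
From mathcomp Require Import all_boot all_order all_algebra.
From mathcomp Require Import zify.

(** The columns of the matrix are the pairs (v, c) of Z_a x Z_a with v != r0,
    and the rows the pairs (k, r) other than (0, r0).  Column (v, c) has in
    the topmost block row its one in row v, and in block row j + 1 its one in
    row c + D(v, j); this covers the row of identity blocks too, because the
    first column of D is zero.  So in each of the four block rows every column
    has exactly one one, and the weights are immediate: 4 for a column, a for
    a row of the topmost block row, and a - 1 for any other row, which meets
    each of the a - 1 remaining column blocks once ([card_incident_rows],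
    [card_incident_cols]).

    A 0/1 matrix satisfies the RC-constraint as soon as no two rows share two
    columns ([RC_constraint_incidence]).  Rows (j + 1, r) and (j' + 1, r')
    share column (v, c) only if D(v, j) - D(v, j') = r - r', so two shared
    columns give two indices v, v' != r0 with the same difference, which is
    where the array matters.  If j or j' is 0 the difference is a value of a
    permutation, up to sign.  For the pair {1, 2}, the a differences are never
    zero, take every non-zero value, and sum to zero, because both columns of
    D have the same sum.  Hence there is one collision; the differences
    without one of its two members are the non-zero residues, whose sum is its
    own opposite, so the colliding value is its own opposite too
    ([near_bijection_collision]).  As a non-zero residue it must be a/2, so
    that r0 is one of the two colliding indices and its removal leaves
    pairwise distinct differences ([diff_inj]). *)

Set Implicit Arguments.
Unset Strict Implicit.
Unset Printing Implicit Defensive.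

Import GRing.Theory.
Local Open Scope ring_scope.

(** * The RC-constraint and incidence *)

Lemma eqF2_1 (b : bool) : (b%:R == 1 :> 'F_2) = b.
Proof. by case: b. Qed.

Lemma sum_natM_F2 (T : finType) (p q : pred T) (f g : T -> 'F_2) :
    (forall x, f x = (p x)%:R) -> (forall x, g x = (q x)%:R) ->
  (\sum_x nat_of_ord (f x) * nat_of_ord (g x) = #|[set x | p x && q x]|)%N.
Proof.
move=> fE gE; rewrite -sum1_card [RHS]big_mkcond; apply: eq_bigr => x _.
by rewrite inE fE gE; case: (p x); case: (q x).
Qed.

Lemma card_relabel (S T : finType) (f : S -> T) (P : pred T) : injective f ->
  #|[set x | P (f x)]| = #|[set y in codom f | P y]|.
Proof.
move=> f_inj; rewrite -(card_imset _ f_inj); apply: eq_card => y.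
rewrite !inE; apply/imsetP/andP => [[x + ->]|[/codomP[x ->] Px]].
  by rewrite inE codom_f.
by exists x; rewrite ?inE.
Qed.

(** Two columns that share two rows give two rows that share two columns, so
    one hypothesis yields both halves of the constraint. *)
Lemma RC_constraint_incidence (l m : nat) (H : 'M['F_2]_(l, m))
    (inc : 'I_l -> 'I_m -> bool) :
    (forall i j, H i j = (inc i j)%:R) ->
    (forall i i' j j', inc i j -> inc i' j -> inc i j' -> inc i' j' ->
       i != i' -> j = j') ->
  RC_constraint H.
Proof.
move=> HE inc_inj; split=> [i i' neq_i | j j' neq_j].
  rewrite (sum_natM_F2 (HE i) (HE i')); apply/card_le1_eqP => j j'.
  by rewrite !inE => /andP[ij i'j] /andP[ij' i'j']; apply: (inc_inj i i').
rewrite (@sum_natM_F2 _ (inc^~ j) (inc^~ j')) //; apply/card_le1_eqP => i i'.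
rewrite !inE => /andP[ij ij'] /andP[i'j i'j']; apply/eqP/contraT => neq_i.
by rewrite (inc_inj _ _ _ _ i'j ij i'j' ij' neq_i) eqxx in neq_j.
Qed.

(** * Differences of the array *)

(** By counting, a map that misses only zero has a single collision, so [d]
    maps the elements other than [u] bijectively to the non-zero ones; the sum
    of the latter is invariant under negation, and equals [- d u]. *)
Lemma near_bijection_collision (T : finZmodType) (d : T -> T) (u u' : T) :
    (forall v, d v != 0) -> (forall x, x != 0 -> exists v, d v = x) ->
    \sum_v d v = 0 -> u != u' -> d u = d u' ->
  {in [set~ u] &, injective d} /\ d u = - d u.
Proof.
move=> d_neq0 d_onto d_sum neq_u du.
(* The value d u is still taken, at u', after u is removed. *)
have d_im : d @: [set~ u] = [set~ 0].
  apply/setP=> x; rewrite !inE; apply/imsetP/idP => [[v _ ->] // | /d_onto[v]].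
  have [-> <-|neq_v <-] := eqVneq v u; last by exists v; rewrite ?inE.
  by exists u'; rewrite // !inE eq_sym.
have d_inj : {in [set~ u] &, injective d}.
  by apply/imset_injP; rewrite d_im !cardsC1.
split=> //; have sumE : d u = - \sum_(x in [set~ (0 : T)]) x.
  apply/eqP; rewrite -addr_eq0 -d_im big_imset //= -[X in _ == X]d_sum.
  by rewrite [in X in _ == X](bigD1 u) //=; apply/eqP; congr (_ + _);
     apply: eq_bigl => v; rewrite !inE.
rewrite {1}sumE -sumrN (reindex_inj (@oppr_inj T)) /= sumE opprK.
by apply: eq_big => x; rewrite ?opprK // !inE oppr_eq0.
Qed.

Lemma sub_modE n (x y : 'I_n.+1) : sub_mod x y = x - y.
Proof. by rewrite /sub_mod /= modnDmr. Qed.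

Lemma eq_opp_half n (x : 'I_n.+1) : x != 0 -> x = - x -> x = n.+1./2 :> nat.
Proof.
move=> x_neq0 /(congr1 (@nat_of_ord _)) /=.
have x_gt0 : (0 < x)%N.
  by rewrite lt0n; apply: contra x_neq0 => /eqP x0; apply/eqP/val_inj.
have x_lt := ltn_ord x; rewrite modn_small => [eq_x|]; lia.
Qed.

Lemma DCA_col_inj a (D : 'M['I_a]_(a, 3)) (j : 'I_3) :
  is_DCA3 D -> j != 0 -> injective (D^~ j).
Proof.
case=> _ + _ j_neq0 u v eq_uv => /(_ j j_neq0 (D u j))/eqP/cards1P[w uvE].
have: u \in [set w] by rewrite -uvE inE.
have: v \in [set w] by rewrite -uvE inE eq_uv.
by rewrite !inE => /eqP-> /eqP.
Qed.

Section Array.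

Variables (n : nat) (D : 'M['I_n.+1]_(n.+1, 3)) (r0 : 'I_n.+1).
Hypothesis hD : is_DCA3 D.
Hypothesis hr0 : sub_mod (D r0 2) (D r0 1) = n.+1./2.

Lemma DCA_col0 v : D v 0 = 0.
Proof. by case: hD => col0 _ _; apply: val_inj; apply: col0. Qed.

(** A collision can occur only at the value a/2, which is the difference of
    the removed row [r0]. *)
Lemma diff21_inj :
  {in [set~ r0] &, injective (fun v => D v 2 - D v 1)}.
Proof.
pose d v := D v 2 - D v 1; move=> u u'; rewrite !inE => u_neq u'_neq du.
have [neq0 onto] : (forall i, sub_mod (D i 2) (D i 1) <> 0%N) /\
    (forall e, (0 < e < n.+1)%N -> exists i, sub_mod (D i 2) (D i 1) = e).
  by case: hD => _ _; apply.
have d_neq0 v : d v != 0.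
  by apply: contra_notN (neq0 v) => /eqP dv0; rewrite sub_modE -/(d v) dv0.
have d_onto x : x != 0 -> exists v, d v = x.
  move=> x_neq0; case: (onto x) => [|v dv].
    rewrite ltn_ord andbT lt0n; apply: contra x_neq0 => /eqP x0.
    exact/eqP/val_inj.
  by exists v; apply: val_inj; rewrite [RHS]/= -dv sub_modE.
have d_sum : \sum_v d v = 0.
  have col_sum j : j != 0 -> \sum_v D v j = \sum_x x.
    by move=> /(DCA_col_inj hD) /(reindex_inj (P := xpredT) (F := id)) ->.
  by rewrite sumrB !col_sum ?subrr.
apply/eqP/contraT => neq_u.
have [d_inj duN] := near_bijection_collision d_neq0 d_onto d_sum neq_u du.
(* Once u is removed, only one row of D has the difference a/2; both u' and
   r0 qualify. *)
suff u'r0 : u' = r0 by rewrite u'r0 eqxx in u'_neq.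
apply: d_inj; rewrite ?inE 1?eq_sym // -[LHS]du; apply: val_inj.
by rewrite /= -[RHS]sub_modE hr0; apply: eq_opp_half (d_neq0 u) duN.
Qed.

(** The orthogonality of the columns of the array, with the row [r0] left
    out; the zero column is treated like the others. *)
Lemma diff_inj (j j' : 'I_3) : j != j' ->
  {in [set~ r0] &, injective (fun v => D v j - D v j')}.
Proof.
have [-> | j_neq0] := eqVneq j 0.
  rewrite eq_sym => j'_neq0 u v _ _; rewrite !DCA_col0 => /addrI/oppr_inj.
  exact: DCA_col_inj.
have [-> _ u v _ _|j'_neq0] := eqVneq j' 0.
  by rewrite !DCA_col0 !subr0; apply: DCA_col_inj.
move=> neq_j; have : (j == 2) && (j' == 1) || (j == 1) && (j' == 2).
  by case: j j' j_neq0 j'_neq0 neq_j => [[|[|[|?]]] // ?] [[|[|[|?]]] // ?].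
case/orP=> /andP[/eqP-> /eqP->]; first exact: diff21_inj.
move=> u v ur vr eq_uv; apply: diff21_inj => //.
by apply: oppr_inj; rewrite !opprB.
Qed.

(** * The positions of the ones *)

(** The row, within block row [k], of the one of column [y.2] of the column
    block [y.1].  Block row [lift ord0 j] is governed by column [j] of the
    array, the identity blocks being those of the zero column. *)
Definition one_row (k : 'I_4) (y : 'I_n.+1 * 'I_n.+1) : 'I_n.+1 :=
  if unlift ord0 k is Some j then y.2 + D y.1 j else y.1.

Lemma circulantE (i r c : 'I_n.+1) : circulant i r c = (r == c + i)%:R.
Proof. by rewrite mxE sub_modE (inj_eq val_inj) eq_sym subr_eq. Qed.

Lemma base_blockE k v r c : base_block D k v r c = (r == one_row k (v, c))%:R.
Proof.
rewrite /one_row /base_block; case: unliftP => [[[|[|[|//]]] lt_j]|] -> /=.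
- rewrite (_ : Ordinal lt_j = 0); last exact: val_inj.
  by rewrite DCA_col0 addr0 mxE.
- by rewrite (_ : Ordinal lt_j = 1); [exact: circulantE | exact: val_inj].
- by rewrite (_ : Ordinal lt_j = 2); [exact: circulantE | exact: val_inj].
- by rewrite mxE.
Qed.

(** A pair of block rows determines the column.  If neither is the topmost,
    the two rows determine the difference of two entries of row y.1 of D, and
    so y.1; otherwise one of them is y.1 itself.  The shift y.2 is then
    obtained by subtraction. *)
Lemma one_row_pair_inj k k' y y' : k != k' -> y.1 != r0 -> y'.1 != r0 ->
  one_row k y = one_row k y' -> one_row k' y = one_row k' y' -> y = y'.
Proof.
have subDD (z x t : 'I_n.+1) : z + x - (z + t) = x - t.
  by rewrite opprD addrACA subrr add0r.
case: y y' => [v c] [v' c'] /=; rewrite /one_row /=.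
case: unliftP => [j|] ->; case: unliftP => [j'|] -> //=.
- rewrite (inj_eq lift_inj) => neq_j vr v'r eq_j eq_j'.
  have eq_v : v = v'.
    apply: (diff_inj neq_j); rewrite ?inE //.
    by rewrite -(subDD c) eq_j eq_j' subDD.
  by rewrite eq_v in eq_j *; rewrite (addIr _ eq_j).
- by move=> _ _ _ + eq_v; rewrite eq_v => /addIr->.
- by move=> _ _ _ eq_v; rewrite eq_v => /addIr->.
Qed.

(** * Labels of the rows and columns *)

Definition block_pos (m b : nat) (s : 'I_(\sum_(k < m) b)) : 'I_m * 'I_b :=
  (tagnat.sig1 s, tagnat.sig2 s).

Definition block_index (m b : nat) (p : 'I_m * 'I_b) : 'I_(\sum_(k < m) b) :=
  tagnat.Rank p.1 p.2.

Lemma block_posK m b : cancel (@block_pos m b) (@block_index m b).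
Proof. exact: tagnat.sig2K. Qed.

Lemma block_indexK m b : cancel (@block_index m b) (@block_pos m b).
Proof.
case=> k r; rewrite /block_pos tagnat.Rank1K tagnat.Rank2K.
by congr pair; apply: val_inj.
Qed.

(** Labels are coordinates in the full matrix, before the deletions. *)
Definition row_label (i : 'I_(4 * n.+1 - 1)) : 'I_4 * 'I_n.+1 :=
  block_pos (lift (block_index (ord0, r0))
                  (cast_ord (esym (size_rows n.+1)) i)).

Definition col_label (j : 'I_(n.+1 ^ 2 - n.+1)) : 'I_n.+1 * 'I_n.+1 :=
  let p := block_pos (cast_ord (esym (size_cols n.+1)) j) in
  (lift r0 p.1, p.2).

Lemma row_label_inj : injective row_label.
Proof.
by move=> i i' /(can_inj (@block_posK _ _)) /lift_inj /cast_ord_inj.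
Qed.

Lemma col_label_inj : injective col_label.
Proof.
move=> j j' eq_jj'; apply: (@cast_ord_inj _ _ (esym (size_cols n.+1))).
apply: (can_inj (@block_posK _ _)); apply: injective_projections.
  exact: lift_inj (congr1 fst eq_jj').
by have := congr1 snd eq_jj'.
Qed.

Lemma codom_row_label p : (p \in codom row_label) = (p != (ord0, r0)).
Proof.
apply/codomP/idP => [[i ->]|p_neq].
  rewrite /row_label -[X in _ != X]block_indexK.
  by rewrite (can_eq (@block_posK _ _)) eq_sym neq_lift.
have : block_index (ord0, r0) != block_index p.
  by rewrite (can_eq (@block_indexK _ _)) eq_sym.
case/unlift_some=> s sE _; exists (cast_ord (size_rows n.+1) s).
by rewrite /row_label cast_ordK -sE block_indexK.
Qed.

Lemma codom_col_label y : (y \in codom col_label) = (y.1 != r0).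
Proof.
apply/codomP/idP => [[j ->]|]; first by rewrite eq_sym neq_lift.
rewrite eq_sym => /unlift_some[v vE _].
exists (cast_ord (size_cols n.+1) (block_index (v, y.2))).
by rewrite /col_label cast_ordK block_indexK -vE -surjective_pairing.
Qed.

Definition incident (p : 'I_4 * 'I_n.+1) (y : 'I_n.+1 * 'I_n.+1) : bool :=
  p.2 == one_row p.1 y.

(** Everything about the matrix is read off this description, in which the
    casts and the nested block indices have disappeared. *)
Lemma HbarE i j :
  Hbar D r0 i j = (incident (row_label i) (col_label j))%:R.
Proof.
rewrite castmxE /= !mxE base_blockE /incident.
set s := tagnat.Rank (lift r0 _) _; rewrite -[(_, tagnat.sig2 s)]/(block_pos s).
by rewrite (block_indexK (lift r0 _, _)).
Qed.

(** A label (k, r) meets column y exactly when r = one_row k y, so there is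
    one for each of the four k; the deleted label (0, r0) is not among them
    because the column block of y is not r0. *)
Lemma card_incident_rows y : y.1 != r0 ->
  #|[set p in codom row_label | incident p y]| = 4%N.
Proof.
move=> y_neq; rewrite -[RHS]card_ord -cardsT.
rewrite -(card_imset [set: 'I_4] (f := fun k => (k, one_row k y))); last first.
  by move=> ? ? [->].
apply: eq_card => -[k r]; rewrite inE codom_row_label /incident /=.
apply/andP/imsetP => [[_ /eqP->]|[k' _ [-> ->]]].
  by exists k; rewrite ?inE.
split=> //; apply: contra_neq y_neq => -[-> <-].
by rewrite /one_row unlift_none.
Qed.

(** Row r of the topmost block row is the all-one row of the single column
    block r.  In any other block row, solving c + D(v, j) = r for c gives one
    column in each block v != r0. *)
Lemma card_incident_cols p : p != (ord0, r0) ->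
  #|[set y in codom col_label | incident p y]| =
    (if p.1 == ord0 then n.+1 else n).
Proof.
case: p => k r; rewrite /incident /one_row /=; case: unliftP => [j|] -> r_neq.
  rewrite eq_sym (negPf (neq_lift _ _)).
  rewrite -[RHS](_ : #|[set~ r0]| = n); last by rewrite cardsC1 card_ord.
  rewrite -(card_imset [set~ r0] (f := fun v => (v, r - D v j))); last first.
    by move=> ? ? [->].
  apply: eq_card => -[v c]; rewrite inE codom_col_label /=.
  rewrite -subr_eq; apply/andP/imsetP => [[v_neq /eqP <-]|[v' + [-> ->]]].
    by exists v; rewrite ?inE.
  by rewrite !inE eqxx.
rewrite eqxx -[RHS]card_ord -cardsT.
rewrite -(card_imset [set: 'I_n.+1] (f := pair r)); last by move=> ? ? [->].
apply: eq_card => -[v c]; rewrite inE codom_col_label /=.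
apply/andP/imsetP => [[_ /eqP->]|[c' _ [-> _]]].
  by exists c; rewrite ?inE.
by split=> //; apply: contra_neq r_neq => ->.
Qed.

(** The rows only have to differ as pairs: two rows of the same block row
    share no column at all. *)
Lemma incident_col_unique i i' y y' : y.1 != r0 -> y'.1 != r0 ->
    incident i y -> incident i' y -> incident i y' -> incident i' y' ->
  i != i' -> y = y'.
Proof.
case: i i' => [k r] [k' r'] yr y'r /eqP/= -> /eqP/= -> /eqP/= e1 /eqP/= e2.
move=> neq_i.
apply: (one_row_pair_inj _ yr y'r e1 e2).
by apply: contra_neq neq_i => ->.
Qed.

End Array.

Theorem lemma4 (a : nat) (ha : (4 <= a)%N) (a_even : ~~ odd a)
    (D : 'M['I_a]_(a, 3)) (hD : is_DCA3 D) (hstd : standard_form D)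
    (r0 : 'I_a) (hr0 : sub_mod (D r0 2%R) (D r0 1%R) = a./2) :
  (exists C : {vspace 'rV['F_2]_(a ^ 2 - a)},
     near_regular_parity_check 4 a C (Hbar D r0)) /\
  RC_constraint (Hbar D r0).
Proof.
case: a ha a_even D hD hstd r0 hr0 => [//|n] _ _ D hD _ r0 hr0.
have row_ok i : row_label r0 i != (ord0, r0).
  by rewrite -codom_row_label codom_f.
have col_ok j : (col_label r0 j).1 != r0.
  by rewrite -codom_col_label codom_f.
split.
  exists (null_space (Hbar D r0)); split=> // [j | i].
    rewrite -[RHS](card_incident_rows D (col_ok j)).
    rewrite -(card_relabel (incident D ^~ (col_label r0 j))
                           (@row_label_inj _ r0)).
    by apply: eq_card => i; rewrite !inE HbarE // eqF2_1.
  have -> : #|[set j | Hbar D r0 i j == 1]| =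
    if (row_label r0 i).1 == ord0 then n.+1 else n.
    rewrite -[RHS](card_incident_cols D (row_ok i)).
    rewrite -(card_relabel (incident D (row_label r0 i))
                           (@col_label_inj _ r0)).
    by apply: eq_card => j; rewrite !inE HbarE // eqF2_1.
  by rewrite subn1; case: ifP; [right | left].
apply: (RC_constraint_incidence (HbarE r0 hD)).
move=> i i' j j' ij i'j ij' i'j' neq_i.
apply: (@col_label_inj _ r0).
apply: (incident_col_unique hD hr0 (col_ok j) (col_ok j') ij i'j ij' i'j').
by rewrite (inj_eq (@row_label_inj _ r0)).
Qed.
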